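(* Let $k\ge 2$ be an integer and let $A\subseteq \mathbb{N}$ be a set such that $r_{1,k}(A,n)=r_{1,k}(\mathbb{N}\setminus A,n)$ for all sufficiently large integers $n$. Then $$\liminf_{n\to\infty}\frac{r_{1,k}(A,n)}{n}>0.$$
   Context: $\mathbb{N}$ denotes the set of all nonnegative integers. For a positive integer $k$, a subset $B\subseteq\mathbb{N}$ and a nonnegative integer $n$, $r_{1,k}(B,n)$ denotes the number of ordered pairs $(a_1,a_2)\in B\times B$ with $n=a_1+ka_2$. *)

(* Defs.v *)
From mathcomp Require Import all_boot all_order all_algebra finmap.
From mathcomp Require Import all_classical all_reals all_analysis.

Set Implicit Arguments.
Unset Strict Implicit.
Unset Printing Implicit Defensive.

Local Open Scope classical_set_scope.
Local Open Scope fset_scope.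
Local Open Scope nat_scope.

Definition reps1 (k : nat) (B : set nat) (n : nat) : set (nat * nat) :=
  [set a | [/\ B a.1, B a.2 & n = a.1 + k * a.2]].

(* [fset_set] sends an infinite set to the empty one; [reps1 k B n] is finite
   as soon as 0 < k, see [finite_reps1]. *)
Definition r1 (k : nat) (B : set nat) (n : nat) : nat :=
  #|` fset_set (reps1 k B n)|.

Lemma finite_reps1 (k : nat) (B : set nat) (n : nat) :
  0 < k -> finite_set (reps1 k B n).
Proof.
move=> k_gt0; apply: (@sub_finite_set _ _ (`I_n.+1 `*` `I_n.+1)); last first.
  by apply: finite_setX; exact: finite_II.
move=> [a b] [/= _ _ ->]; split=> /=; rewrite ltnS.
  exact: leq_addr.
by rewrite (leq_trans (leq_pmull b k_gt0))// leq_addl.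
Qed.

(* Main.v *)
Require Import Defs.
From mathcomp Require Import all_boot all_order all_algebra.
From mathcomp Require Import all_classical all_reals all_analysis.
From mathcomp Require Import finmap zify.

Import Order.TTheory Num.Theory.
Local Open Scope classical_set_scope.

(** Comparing the hypothesis at [n] and [n + k] shows that, for large [n],
    exactly one of [n] and [n %/ k] belongs to [A]. Hence [A] is constant on each
    block [m * k ^ t, (m + 1) * k ^ t) with [m] large, and scaling a block by [k]
    exchanges [A] with its complement. Given [n], choose [t] so that
    [n %/ k ^ t] is large but bounded. As [k * j] runs over a suitable range, of
    length proportional to [n], [n - k * j] stays in one block of level [t],
    while the range contains both a long run of [j] in [A] and a long run of [j]
    outside [A]. Taking the run of the same sign as the block gives linearly many
    representations by [A] or by its complement, and these are equinumerous. *)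

Lemma card_fset_set_seq (T : choiceType) (X : set T) (s : seq T) :
  uniq s -> (forall x, X x <-> x \in s) -> #|` fset_set X|%fset = size s.
Proof.
move=> s_uniq XE.
have -> : X = [set` [fset x in s]%fset].
  by apply/seteqP; split=> x /=; rewrite inE => /XE.
by rewrite set_fsetK card_fseq undup_id.
Qed.

(** The second coordinate determines the pair, and [j <= n %/ k] keeps the truncated subtraction
    [n - k * j] exact. *)
Lemma r1_count (k : nat) (A : set nat) (n : nat) : (0 < k)%N ->
  r1 k A n = count (fun j => (n - k * j \in A) && (j \in A)) (iota 0 (n %/ k).+1).
Proof.
move=> k_gt0; rewrite -size_filter /r1.
rewrite -(size_map (fun j => (n - k * j, j)%N)).
apply: card_fset_set_seq.
  by rewrite map_inj_uniq ?filter_uniq ?iota_uniq // => i j [].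
move=> [i j]; split.
  move=> -[]; rewrite [(i, j).1]/= [(i, j).2]/= => Ai Aj nE; apply/mapP; exists j; last by rewrite nE addnK.
  rewrite mem_filter mem_iota add0n ltnS leq_divRL // nE addnK !mem_set //.
  by rewrite mulnC leq_addl.
move=> /mapP [j0]; rewrite mem_filter mem_iota add0n ltnS leq_divRL //=.
move=> /andP[/andP[/set_mem Ai /set_mem Aj] le] [-> ->]; split=> //=.
by rewrite subnK // mulnC.
Qed.

Lemma count_andN (T : Type) (p q : pred T) (s : seq T) :
  (count (fun x => p x && q x) s + size s
   = count (fun x => ~~ p x && ~~ q x) s + (count p s + count q s))%N.
Proof.
elim: s => //= x s.
by case: (p x); case: (q x) => /=; lia.
Qed.

(** By inclusion-exclusion, equality at [m] forces [S m = (m %/ k).+1]. From [n] to [k + n] this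
    total grows by one, while the two counts gain exactly the indicators of [k + n] and of
    [(k + n) %/ k]. *)
Lemma eq_r1_setC_flip (k : nat) (A : set nat) (n : nat) : (0 < k)%N ->
  r1 k A n = r1 k (~` A) n -> r1 k A (k + n) = r1 k (~` A) (k + n) ->
  (k + n \in A) = ((k + n) %/ k \notin A).
Proof.
move=> k_gt0; have -> : ((k + n) %/ k = (n %/ k).+1)%N.
  by rewrite divnDl // divnn k_gt0.
set N := (n %/ k)%N.
pose S m := (count (fun j => (m - k * j)%N \in A) (iota 0 (m %/ k).+1)
  + count (fun j => j \in A) (iota 0 (m %/ k).+1))%N.
have sumE m : r1 k A m = r1 k (~` A) m -> S m = (m %/ k).+1.
  rewrite !r1_count //.
  under [in RHS]eq_count do rewrite !in_setC.
  move=> eqr.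
  have := count_andN _ (fun j => (m - k * j)%N \in A) (fun j => j \in A)
    (iota 0 (m %/ k).+1).
  by rewrite eqr size_iota /S; lia.
(* The term [j = 0] is new; shifting the other indices by one cancels [k]. *)
have cons_count : count (fun j => (k + n - k * j)%N \in A) (iota 0 N.+2)
    = ((k + n \in A) + count (fun j => (n - k * j)%N \in A) (iota 0 N.+1))%N.
  rewrite -[N.+2]add1n iotaD count_cat; congr addn.
    by rewrite /= muln0 subn0 addn0.
  rewrite [(0 + 1)%N]addnC (iotaDl 1 0 N.+1) count_map; apply: eq_count => j /=.
  by rewrite mulnDr muln1 subnDl.
have rcons_count : count (fun j => j \in A) (iota 0 N.+2)
    = (count (fun j => j \in A) (iota 0 N.+1) + (N.+1 \in A))%N.
  by rewrite -[in LHS]addn1 iotaD count_cat add0n; congr addn; rewrite /= addn0.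
move=> /sumE S1 /sumE; move: S1.
rewrite /S divnDl ?dvdnn // divnn k_gt0 add1n -/N cons_count rcons_count.
by case: (k + n \in A); case: (N.+1 \in A) => /=; lia.
Qed.

Lemma flip_block (k M : nat) (a : pred nat) : (0 < k)%N ->
  (forall n, (M <= n)%N -> a n = ~~ a (n %/ k)) ->
  forall t n, (M <= n %/ k ^ t)%N -> a n = a (n %/ k ^ t) (+) odd t.
Proof.
move=> k_gt0 flip; elim=> [|t IHt] n; first by rewrite expn0 divn1 addbF.
rewrite expnSr divnMA => le_M.
have le_M' : (M <= n %/ k ^ t)%N by apply: leq_trans le_M (leq_div _ _).
by rewrite (IHt _ le_M') (flip _ le_M') /= addbN addNb.
Qed.

(** The blocks of [M] at levels [r] and [r.+1] carry opposite signs. One of them has sign [b], and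
    its first [k ^ r] elements serve. *)
Lemma run_of_sign (k M : nat) (a : pred nat) : (0 < k)%N ->
  (forall n, (M <= n)%N -> a n = ~~ a (n %/ k)) ->
  forall (r : nat) (b : bool), exists x,
    [/\ (M * k ^ r <= x)%N, (x + k ^ r <= M.+1 * k ^ r.+1)%N
      & forall j, (x <= j < x + k ^ r)%N -> a j = b].
Proof.
move=> k_gt0 flip r b.
have run t j : (M * k ^ t <= j < M.+1 * k ^ t)%N -> a j = a M (+) odd t.
  move=> /andP[le_j lt_j].
  have jE : (j %/ k ^ t = M)%N.
    apply/eqP; rewrite eqn_leq leq_divRL ?expn_gt0 ?k_gt0 // le_j andbT.
    by rewrite -ltnS ltn_divLR ?expn_gt0 ?k_gt0.
  by rewrite (flip_block k M a k_gt0 flip t) jE.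
have lekS : (k ^ r <= k ^ r.+1)%N by rewrite leq_pexp2l.
have [ab|ab] := eqVneq (a M (+) odd r) b.
  exists (M * k ^ r)%N; split=> //.
    by rewrite addnC -mulSn leq_mul2l lekS orbT.
  by move=> j; rewrite [(_ + k ^ r)%N]addnC -mulSn => /run ->.
exists (M * k ^ r.+1)%N; split.
- by rewrite leq_mul2l lekS orbT.
- by rewrite addnC mulSn leq_add2r.
move=> j /andP[le_j lt_j]; rewrite (run r.+1).
  by rewrite /= addbN; move: ab; case: (_ (+) _); case: b.
by rewrite le_j (leq_trans lt_j) // addnC mulSn leq_add2r.
Qed.

Lemma common_run (k M : nat) (a : pred nat) : (2 <= k)%N -> (0 < M)%N ->
  (forall n, (M <= n)%N -> a n = ~~ a (n %/ k)) ->
  exists C N0, forall n, (N0 <= n)%N ->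
    exists (b : bool) (x L : nat), (n <= C * L)%N /\
      forall j, (x <= j < x + L)%N ->
        [/\ (k * j <= n)%N, a j = b & a (n - k * j)%N = b].
Proof.
move=> k_gt1 M_gt0 flip; have k_gt0 : (0 < k)%N by exact: ltnW.
(* [k ^ w] absorbs the factor [M.+1], so that [k * j <= k ^ (r + s)] on a run of level [r]. The
   threshold for [n] gives [2 * s <= t], leaving room for runs of levels [t - s] and [t - 2 * s];
   the constant compares [n < M.+1 * k ^ t.+1] with the shorter length. *)
have [w le_w] : exists w, (M.+1 <= k ^ w)%N by exists M.+1; exact/ltnW/ltn_expl.
pose s := w.+2.
exists (M.+1 * k ^ (2 * s).+1)%N, (M.+1 * k ^ (2 * s))%N => n le_n.
have k_pos e : (0 < k ^ e)%N by rewrite expn_gt0 k_gt0.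
have n_gt0 : (0 < n %/ M.+1)%N.
  by rewrite divn_gt0 // (leq_trans _ le_n) // leq_pmulr.
have [t [t_ge t_le n_lt]] : exists t,
    [/\ (2 * s <= t)%N, (M.+1 * k ^ t <= n)%N & (n < M.+1 * k ^ t.+1)%N].
  have /andP[] := trunc_log_bounds k_gt1 n_gt0; set t := trunc_log _ _.
  rewrite leq_divRL // ltn_divLR // ![(k ^ _ * _)%N]mulnC => lo hi.
  exists t; split=> //; rewrite -ltnS -(ltn_exp2l _ _ k_gt1).
  by rewrite -(ltn_pmul2l (ltn0Sn M)) (leq_ltn_trans le_n).
have scale r : (t - 2 * s <= r)%N -> (n <= M.+1 * k ^ (2 * s).+1 * k ^ r)%N.
  move=> le_r; apply: ltnW; apply: leq_trans n_lt _.
  by rewrite -mulnA -expnD leq_mul2l leq_pexp2l ?orbT //; lia.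
have run_end r x j : (x + k ^ r <= M.+1 * k ^ r.+1)%N -> (j < x + k ^ r)%N ->
    (k * j <= k ^ (w + r.+2))%N.
  move=> x_le j_lt; rewrite expnD.
  apply: leq_trans (_ : M.+1 * k ^ r.+2 <= _)%N; last by rewrite leq_mul2r le_w orbT.
  rewrite expnS mulnCA leq_mul2l; apply/orP; right.
  exact: leq_trans (ltnW j_lt) x_le.
have nE := divn_eq n (k ^ t); set m := (n %/ k ^ t)%N in nE.
set p := (n %% k ^ t)%N in nE.
have p_lt : (p < k ^ t)%N by rewrite ltn_mod.
have m_ge : (M.+1 <= m)%N by rewrite leq_divRL.
(* If [p] is large, a run of level [t - 2 * s] has [k * j <= p], so [n - k * j] stays in block
   [m]. *)
have [le_p|lt_p] := leqP (k ^ (t - s)) p.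
  have [x [_ x_le x_run]] :=
    run_of_sign k M a k_gt0 flip (t - 2 * s) (a m (+) odd t).
  exists (a m (+) odd t), x, (k ^ (t - 2 * s))%N; split; first exact: scale.
  move=> j j_in; have /andP[_ j_lt] := j_in.
  have kj_le : (k * j <= p)%N.
    apply: leq_trans le_p; apply: leq_trans (run_end _ _ _ x_le j_lt) _.
    by rewrite leq_pexp2l // /s; lia.
  have dE : ((n - k * j) %/ k ^ t = m)%N.
    by rewrite nE -addnBA // divnMDl // divn_small ?addn0 //; lia.
  split; [lia|exact: x_run|].
  by rewrite (flip_block k M a k_gt0 flip t) dE // ltnW.
(* If [p] is small, a run of level [t - s] starts beyond [p], as [0 < M], and has [k * j <= k ^ t]:
   every [n - k * j] falls in block [m.-1], still at least [M]. *)
have [x [x_ge x_le x_run]] :=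
  run_of_sign k M a k_gt0 flip (t - s) (a m.-1 (+) odd t).
exists (a m.-1 (+) odd t), x, (k ^ (t - s))%N; split; first by apply: scale; lia.
move=> j j_in; have /andP[j_ge j_lt] := j_in.
have kj_le : (k * j <= k ^ t)%N.
  apply: leq_trans (run_end _ _ _ x_le j_lt) _.
  by rewrite leq_pexp2l // /s; lia.
have kj_gt : (p < k * j)%N.
  apply: leq_trans lt_p _; apply: leq_trans (leq_pmull j k_gt0).
  by apply: leq_trans j_ge; apply: leq_trans x_ge; exact: leq_pmull.
have nE' : n = (m.-1 * k ^ t + (k ^ t + p))%N.
  by rewrite addnA -mulSnr prednK // (leq_trans _ m_ge).
have dE : ((n - k * j) %/ k ^ t = m.-1)%N.
  rewrite nE' -addnBA; last by lia.
  by rewrite divnMDl // divn_small ?addn0 //; lia.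
split; [lia|exact: x_run|].
by rewrite (flip_block k M a k_gt0 flip t) dE //; lia.
Qed.

Lemma limn_einf_gt0 (R : realType) (u : nat -> nat) (C N0 : nat) :
  (forall n, (N0 <= n)%N -> (n <= C * u n)%N) ->
  (0 < limn_einf (fun n : nat => ((u n)%:R / n%:R : R)%R%:E))%E.
Proof.
move=> u_ge; set v := fun n => _; rewrite limn_einf_lim.
have -> : limn (einfs v) = ereal_sup (range (einfs v)).
  by apply/cvg_lim => //; exact: cvg_einfs_sup.
(* [C.+1] is invertible even when [C = 0]; likewise the tail from [N0.+1] avoids division by
   zero. *)
have C_gt0 : (0 < (C.+1%:R^-1 : R))%R by rewrite invr_gt0 ltr0Sn.
apply: (@lt_le_trans _ _ (C.+1%:R^-1 : R)%R%:E); first by rewrite lte_fin.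
apply: (@le_trans _ _ (einfs v N0.+1)); last first.
  by apply: ereal_sup_ubound; exists N0.+1.
apply: le_ereal_inf_tmp => _ [n /= n_ge <-].
have n_gt0 : (0 < n)%N by exact: leq_ltn_trans n_ge.
rewrite lee_fin ler_pdivlMr ?ltr0n // ler_pdivrMl ?ltr0Sn //.
rewrite -GRing.natrM ler_nat (leq_trans (u_ge n (ltnW n_ge))) //.
by rewrite leq_mul2r leqnSn orbT.
Qed.

Theorem theorem1p1 (R : realType) (k : nat) (A : set nat) :
  (2 <= k)%N ->
  (\forall n \near \oo, r1 k A n = r1 k (~` A) n) ->
  (0 < limn_einf (fun n : nat => ((r1 k A n)%:R / n%:R : R)%R%:E))%E.
Proof.
move=> k_gt1 [N0 _ eqr]; have k_gt0 : (0 < k)%N by exact: ltnW.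
have flip n : (N0 + k <= n)%N -> (n \in A) = ~~ (n %/ k \in A).
  move=> le_n; rewrite -(subnKC (leq_trans (leq_addl _ _) le_n)).
  by apply: eq_r1_setC_flip => //; apply: eqr => /=; lia.
have [|C [N1 runs]] := common_run k (N0 + k) (fun n => n \in A) k_gt1 _ flip.
  by rewrite addn_gt0 k_gt0 orbT.
apply: (@limn_einf_gt0 R _ C (N0 + N1)) => n le_n.
have [|b [x [L [n_le run]]]] := runs n; first by lia.
apply: (leq_trans n_le); rewrite leq_mul2l; apply/orP; right.
(* A run of sign [false] is a run of sign [true] for the complement, which satisfies the same
   hypotheses and has the same count at [n]. *)
wlog bE : A b eqr flip run {runs} / b = true.
  move=> IH; case: b run => run; first exact: (IH A true).
  rewrite eqr; last by rewrite /=; lia.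
  apply: (IH (~` A) true) => //.
  - by move=> m le_m; rewrite setCK -eqr.
  - by move=> m le_m; rewrite !in_setC flip.
  by move=> j /run; rewrite !in_setC => -[-> -> ->].
(* Each [j] of the run contributes its own representation, so the count is at least [L]. *)
rewrite r1_count // -size_filter -[L](size_iota x).
apply: uniq_leq_size; first exact: iota_uniq.
move=> j; rewrite mem_iota => /run; rewrite bE => -[le Aj Ai].
by rewrite mem_filter Ai Aj mem_iota add0n ltnS leq_divRL // mulnC.
Qed.
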